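(* Let $\mathbb{k}$ be a field and let $\mathcal A=\{\ell_1,\dots,\ell_n\}\subset R=\mathbb{k}[x_1,\dots,x_k]$ be a central arrangement of rank $k\ge 2$ and size $n\ge k$. Then the ideal $I_{n-1}(\mathcal A)$ of $(n-1)$-fold products of $\mathcal A$ is of fiber type, that is, $$\mathcal I(\mathcal A,n-1)=\mathcal I_1(\mathcal A,n-1)+\langle \mathcal I(\mathcal A,n-1)_{(0,-)}\rangle$$ as ideals of $T=R[y_1,\dots,y_n]$, where the ideal of $S=\mathbb{k}[y_1,\dots,y_n]$ generated by $\mathcal I(\mathcal A,n-1)_{(0,-)}$ is the Orlik-Terao ideal $\partial(\mathcal A)$.
   Context: A central arrangement of size $n$ and rank $k$ is given by $n$ pairwise non-proportional nonzero linear forms $\ell_1,\dots,\ell_n\in R=\mathbb{k}[x_1,\dots,x_k]$ with $\langle \ell_1,\dots,\ell_n\rangle=\langle x_1,\dots,x_k\rangle$. Put $f_i=\prod_{j\ne i}\ell_j$ and $I=I_{n-1}(\mathcal A)=\langle f_1,\dots,f_n\rangle$. Let $T=R[y_1,\dots,y_n]$, bigraded by $\deg x_i=(1,0)$, $\deg y_j=(0,1)$. The Rees ideal $\mathcal I(\mathcal A,n-1)\subset T$ is the kernel of the $R$-algebra map $T\to R[It]$, $y_i\mapsto f_it$. The ideal $\mathcal I_1(\mathcal A,n-1)\subset T$ is generated by all $s_1y_1+\cdots+s_ny_n$ with $s_i\in R$ and $\sum s_if_i=0$ (so $T/\mathcal I_1(\mathcal A,n-1)$ is the symmetric algebra of $I$).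 $\mathcal I(\mathcal A,n-1)_{(0,-)}$ is the set of elements of $\mathcal I(\mathcal A,n-1)$ lying in $S=\mathbb{k}[y_1,\dots,y_n]$, i.e. of $x$-degree $0$. For a linear dependency $D:\ c_{i_1}\ell_{i_1}+\cdots+c_{i_m}\ell_{i_m}=0$ with all $c_{i_j}\ne0$, put $\partial D=\sum_{j=1}^m c_{i_j}\prod_{r\ne j}y_{i_r}\in S$. The Orlik-Terao ideal $\partial(\mathcal A)\subset S$ is the ideal generated by all such $\partial D$. *)

(* Defs.v *)
From HB Require Import structures.
From mathcomp Require Import all_boot all_order all_algebra.
From mathcomp Require Export mpoly.

Set Implicit Arguments.
Unset Strict Implicit.
Unset Printing Implicit Defensive.

Import GRing.Theory.

Local Open Scope ring_scope.

Section Ideals.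
Variable A : comNzRingType.

Definition ideal_gen (G : A -> Prop) (p : A) : Prop :=
  exists (m : nat) (a g : 'I_m -> A),
    (forall i, G (g i)) /\ p = \sum_(i < m) a i * g i.

Definition ideal_add (I J : A -> Prop) (p : A) : Prop :=
  exists u v : A, [/\ I u, J v & p = u + v].

Definition ideal_eq (I J : A -> Prop) : Prop := forall p, I p <-> J p.

End Ideals.

Section Arrangement.
Variables (F : fieldType) (k n : nat) (ell : 'I_n -> {mpoly F[k]}).

Notation R := {mpoly F[k]}.
Notation S := {mpoly F[n]}.
Notation T := {mpoly {mpoly F[k]}[n]}.

Definition central_arrangement : Prop :=
  [/\ forall i, ell i \is 1.-homog,
      forall i, ell i != 0,
      forall i j, i != j -> forall c : F, ell i != c *: ell j
    & ideal_eq (ideal_gen (fun p : R => exists i : 'I_n, p = ell i))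
               (ideal_gen (fun p : R => exists i : 'I_k, p = 'X_i))].

Definition fold_gen (i : 'I_n) : R := \prod_(j < n | j != i) ell j.

(* The map T -> R[It], with R[It] viewed inside the polynomial ring R[t]; its
   kernel does not depend on this enlargement of the codomain. *)
Definition rees_map : T -> {poly R} :=
  mmap polyC (fun i => fold_gen i *: 'X).

Definition rees_ideal (p : T) : Prop := rees_map p = 0.

Definition sym_ideal : T -> Prop :=
  ideal_gen (fun p : T => exists s : 'I_n -> R,
    \sum_(i < n) s i * fold_gen i = 0 /\ p = \sum_(i < n) s i *: 'X_i).

Definition y_incl : S -> T := map_mpoly (@mpolyC k F).

Definition rees_ideal0 (q : S) : Prop := rees_ideal (y_incl q).

Definition rees_ideal0_ext : T -> Prop :=
  ideal_gen (fun p : T => exists q : S, rees_ideal0 q /\ p = y_incl q).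

(* A linear dependency is given by its support D, a set of distinct indices,
   and coefficients c, of which only the values on D matter. *)
Definition dependency (D : {set 'I_n}) (c : 'I_n -> F) : Prop :=
  (forall i, i \in D -> c i != 0) /\ \sum_(i in D) c i *: ell i = 0.

Definition dependency_diff (D : {set 'I_n}) (c : 'I_n -> F) : S :=
  \sum_(i in D) c i *: \prod_(r in D :\ i) 'X_r.

Definition orlik_terao_ideal : S -> Prop :=
  ideal_gen (fun q : S => exists (D : {set 'I_n}) (c : 'I_n -> F),
    dependency D c /\ q = dependency_diff D c).

Definition fiber_type : Prop :=
  ideal_eq rees_ideal (ideal_add sym_ideal rees_ideal0_ext).

End Arrangement.

(* Main.v *)
(** Adjoin a new indeterminate [h] to the coefficients.  Since
    [f_i t = (prod_j ell_j) t / ell_i], the Rees ideal is the kernel of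
    [y_i |-> h / ell_i], and the main point is that this kernel is generated by
    the [ell_i y_i - h] and the [∂D], for nonzero linear forms [ell_i], some of
    which may be proportional.  Eliminate one variable [y_i] at a time: in an
    element of the kernel, the leading coefficient with respect to [y_i] lies,
    after restriction to the hyperplane [ell_i = 0], in the kernel for the
    restricted arrangement, which is smaller.  A dependency of the restricted
    forms extends to one of the form [D + i], and
    [∂(D + i) = y_i ∂D + c_i prod_D y], so the leading term can be traded for
    terms of lower degree in [y_i].  If a form restricts to [0], it is
    proportional to [ell_i] and the two-element dependency lowers the degree.
    Finally, [h |-> ell_0 y_0] maps the generators into the fiber-type ideal,
    and [h, x |-> 0] maps them into the Orlik-Terao ideal. *)
Require Import Defs.
From HB Require Import structures.
From mathcomp Require Import all_boot all_order all_algebra.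
From mathcomp Require Import mpoly.
From mathcomp Require Import ring.

Set Implicit Arguments.
Unset Strict Implicit.
Unset Printing Implicit Defensive.

Import GRing.Theory.
Local Open Scope ring_scope.

(** * Ideals given by generators, and sums of two such ideals *)

Section IdealGen.
Variables (A : comNzRingType) (G : A -> Prop).

Lemma ideal_gen_mem g : G g -> ideal_gen G g.
Proof.
move=> Gg; exists 1%N, (fun=> 1), (fun=> g); split=> //.
by rewrite big_ord1 mul1r.
Qed.

Lemma ideal_gen0 : ideal_gen G 0.
Proof.
exists 0%N, (fun=> 0), (fun=> 0); split; first by case.
by rewrite big_ord0.
Qed.

Lemma ideal_genD p q : ideal_gen G p -> ideal_gen G q -> ideal_gen G (p + q).
Proof.
move=> [m [a [g [Gg ->]]]] [m' [a' [g' [Gg' ->]]]].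
exists (m + m')%N, (fun i => match split i with inl j => a j | inr j => a' j end),
  (fun i => match split i with inl j => g j | inr j => g' j end); split.
  by move=> i; case: split.
rewrite big_split_ord /=; congr (_ + _); apply: eq_bigr => i _.
  by rewrite (unsplitK (inl i)).
by rewrite (unsplitK (inr i)).
Qed.

Lemma ideal_genM a p : ideal_gen G p -> ideal_gen G (a * p).
Proof.
move=> [m [b [g [Gg ->]]]]; exists m, (fun i => a * b i), g; split=> //.
by rewrite mulr_sumr; apply: eq_bigr => i _; rewrite mulrA.
Qed.

Lemma ideal_gen_ind (P : A -> Prop) :
    P 0 -> (forall p q, P p -> P q -> P (p + q)) ->
    (forall a g, G g -> P (a * g)) ->
  forall p, ideal_gen G p -> P p.
Proof. by move=> P0 PD PM p [m [a [g [Gg ->]]]]; apply: (big_ind P) => // i _; apply: PM. Qed.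

End IdealGen.

Lemma ideal_gen_sub (A : comNzRingType) (G H : A -> Prop) p :
  (forall g, G g -> ideal_gen H g) -> ideal_gen G p -> ideal_gen H p.
Proof.
move=> GH; apply: ideal_gen_ind => [|u v|a g /GH]; first exact: ideal_gen0.
  exact: ideal_genD.
exact: ideal_genM.
Qed.

Lemma ideal_add0 (A : comNzRingType) (G H : A -> Prop) :
  ideal_add (ideal_gen G) (ideal_gen H) 0.
Proof. by exists 0, 0; rewrite addr0; split=> //; apply: ideal_gen0. Qed.

Lemma ideal_addD (A : comNzRingType) (G H : A -> Prop) p q :
  ideal_add (ideal_gen G) (ideal_gen H) p -> ideal_add (ideal_gen G) (ideal_gen H) q ->
  ideal_add (ideal_gen G) (ideal_gen H) (p + q).
Proof.
move=> [u [v [Iu Iv ->]]] [u' [v' [Iu' Iv' ->]]].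
by exists (u + u'), (v + v'); split; [exact: ideal_genD | exact: ideal_genD | rewrite addrACA].
Qed.

Lemma ideal_addM (A : comNzRingType) (G H : A -> Prop) a p :
  ideal_add (ideal_gen G) (ideal_gen H) p ->
  ideal_add (ideal_gen G) (ideal_gen H) (a * p).
Proof.
move=> [u [v [Iu Iv ->]]].
by exists (a * u), (a * v); split; [exact: ideal_genM | exact: ideal_genM | rewrite mulrDr].
Qed.

(** * Induction and extensionality over a polynomial ring *)

Section MPolyRing.
Variables (n : nat) (R : nzRingType).

Lemma mpoly_ring_ind (P : {mpoly R[n]} -> Prop) :
    (forall c, P c%:MP) -> (forall i, P 'X_i) ->
    (forall p q, P p -> P q -> P (p + q)) -> (forall p q, P p -> P q -> P (p * q)) ->
  forall p, P p.
Proof.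
move=> PC PX PD PM p; have P0 : P 0 by rewrite -mpolyC0.
have P1 : P 1 by rewrite -mpolyC1.
rewrite (mpolyE p); apply: (big_ind P) => // m _.
rewrite -mul_mpolyC; apply/PM => //; rewrite mpolyXE_id.
apply: (big_ind P) => // i _; elim: (m i) => [|d IHd]; first by rewrite expr0.
by rewrite exprS; apply: PM.
Qed.

Lemma mpoly_rmorph_ext (S : nzRingType) (f g : {rmorphism {mpoly R[n]} -> S}) :
  (forall c, f c%:MP = g c%:MP) -> (forall i, f 'X_i = g 'X_i) -> f =1 g.
Proof.
move=> eqC eqX; elim/mpoly_ring_ind => // p q eqp eqq.
  by rewrite !rmorphD eqp eqq.
by rewrite !rmorphM eqp eqq.
Qed.

End MPolyRing.

(** With [x] the image of a form and [y] that of [h], this pulls the full product of the values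
    [h / l_r] out of one term of a circuit. *)
Lemma mul_div_div (K : fieldType) (a x y z : K) :
  x != 0 -> y != 0 -> a * z = a * x / y * (y / x * z).
Proof. by move=> x0 y0; field; rewrite x0 y0. Qed.

(** * Specialization of fractions with denominator outside a kernel *)

Section LocalMorphism.
Variables (R : idomainType) (K : fieldType) (frac : {rmorphism R -> K}).
Hypothesis frac_inj : injective frac.
Variable sigma : {rmorphism R -> R}.
Local Notation "x %:F" := (frac x).

Lemma frac_eq0 a : (a%:F == 0) = (a == 0).
Proof. by rewrite -(inj_eq frac_inj) rmorph0. Qed.

(* The graph of the morphism induced by [sigma] on the local ring at its
   kernel. *)
Definition local_graph (x y : K) : Prop :=
  exists a b : R, [/\ sigma b != 0, x * b%:F = a%:F & y * (sigma b)%:F = (sigma a)%:F].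

Lemma local_graph_frac a : local_graph a%:F (sigma a)%:F.
Proof. by exists a, 1; rewrite rmorph1 oner_eq0 !rmorph1 !mulr1. Qed.

Lemma local_graphD x y x' y' :
  local_graph x y -> local_graph x' y' -> local_graph (x + x') (y + y').
Proof.
move=> [a [b [b0 xa yb]]] [a' [b' [b'0 xa' yb']]].
exists (a * b' + a' * b), (b * b'); split.
- by rewrite rmorphM mulf_neq0.
- by rewrite !(rmorphD, rmorphM) /= -xa -xa'; ring.
- by rewrite !(rmorphD, rmorphM) /= -yb -yb'; ring.
Qed.

Lemma local_graphM x y x' y' :
  local_graph x y -> local_graph x' y' -> local_graph (x * x') (y * y').
Proof.
move=> [a [b [b0 xa yb]]] [a' [b' [b'0 xa' yb']]].
exists (a * a'), (b * b'); split.
- by rewrite rmorphM mulf_neq0.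
- by rewrite !rmorphM /= -xa -xa'; ring.
- by rewrite !rmorphM /= -yb -yb'; ring.
Qed.

Lemma local_graph_div a b : b != 0 -> sigma b != 0 ->
  local_graph (a%:F / b%:F) ((sigma a)%:F / (sigma b)%:F).
Proof.
by move=> b0 sb0; exists a, b; split=> //; rewrite divfK ?frac_eq0.
Qed.

(** As [frac] is injective, a zero fraction has zero numerator [a], and [sigma a] is zero too.
    Identities in [K] thus pass to the specialization. *)
Lemma local_graph_fun0 y : local_graph 0 y -> y = 0.
Proof.
move=> [a [b [b0]]]; rewrite mul0r => /esym/eqP; rewrite frac_eq0 => /eqP->.
by rewrite !rmorph0 => /eqP; rewrite mulf_eq0 frac_eq0 (negbTE b0) orbF => /eqP.
Qed.

Lemma local_graph_sum (I : Type) (r : seq I) (x y : I -> K) :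
  (forall i, local_graph (x i) (y i)) ->
  local_graph (\sum_(i <- r) x i) (\sum_(i <- r) y i).
Proof.
move=> xy; apply: (big_ind2 local_graph) => //.
  by have := local_graph_frac 0; rewrite !rmorph0.
by move=> *; apply: local_graphD.
Qed.

Lemma local_graph_mpoly (n : nat) (f g : {rmorphism {mpoly R[n]} -> K}) :
    (forall a, local_graph (f a%:MP) (g a%:MP)) ->
    (forall i, local_graph (f 'X_i) (g 'X_i)) ->
  forall p, local_graph (f p) (g p).
Proof.
move=> fgC fgX; elim/mpoly_ring_ind => // p q fgp fgq.
  by rewrite !rmorphD; apply: local_graphD.
by rewrite !rmorphM; apply: local_graphM.
Qed.

End LocalMorphism.

(** * The kernel of the evaluation of [y_i] at [h / l_i] *)

Section Relations.
Variables (F : fieldType) (R : idomainType) (K : fieldType) (n : nat).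
Variable frac : {rmorphism R -> K}.
Hypothesis frac_inj : injective frac.
Variables (iota : {rmorphism F -> R}) (h : R).
Hypothesis h_neq0 : h != 0.

Local Notation T := {mpoly R[n]}.
Local Notation "x %:F" := (frac x).
Local Notation frac_eq0 := (frac_eq0 frac_inj).
Local Notation local_graph := (local_graph frac).
Implicit Types (A B D : {set 'I_n}) (l : 'I_n -> R) (c : 'I_n -> F) (p q : T).

(* Unlike in [dependency_diff], coefficients may vanish: this spares a case
   distinction when a dependency is lifted from a hyperplane. *)
Definition circuit_diff D c : T :=
  \sum_(i in D) (iota (c i))%:MP * \prod_(r in D :\ i) 'X_r.

Definition relation A l (p : T) : Prop :=
  (exists2 i, i \in A & p = (l i)%:MP * 'X_i - h%:MP) \/
  (exists D c, [/\ D \subset A, \sum_(i in D) iota (c i) * l i = 0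
                 & p = circuit_diff D c]).

Definition inv_eval l : T -> K := mmap frac (fun i => h%:F / (l i)%:F).
HB.instance Definition _ l := GRing.RMorphism.copy (inv_eval l)
  (mmap frac (fun i => h%:F / (l i)%:F)).

(* Sets the variables outside [A] to zero, so that [restr A p = p] says that [p]
   only involves the variables indexed by [A]. *)
Definition restr A : T -> T :=
  mmap (@mpolyC n R) (fun i => if i \in A then 'X_i else 0).
HB.instance Definition _ A := GRing.RMorphism.copy (restr A)
  (mmap (@mpolyC n R) (fun i => if i \in A then 'X_i else 0)).

Lemma inv_evalC l a : inv_eval l a%:MP = a%:F.
Proof. exact: mmapC. Qed.

Lemma inv_evalX l i : inv_eval l 'X_i = h%:F / (l i)%:F.
Proof. by rewrite [LHS]mmapX mmap1U. Qed.

Lemma restrC A a : restr A a%:MP = a%:MP.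
Proof. exact: mmapC. Qed.

Lemma restrX A i : restr A 'X_i = if i \in A then 'X_i else 0.
Proof. by rewrite [LHS]mmapX mmap1U. Qed.

Lemma restr_prod A D : D \subset A ->
  restr A (\prod_(r in D) 'X_r) = \prod_(r in D) 'X_r.
Proof.
move=> /subsetP DA; rewrite rmorph_prod; apply: eq_bigr => i /DA iA.
by rewrite /= restrX iA.
Qed.

Lemma restr_idem A p : restr A (restr A p) = restr A p.
Proof.
elim/mpoly_ring_ind: p => [a|i|p q IHp IHq|p q IHp IHq].
- by rewrite !restrC.
- by rewrite !restrX; case: ifP => iA; rewrite ?restrX ?iA ?rmorph0.
- by rewrite !rmorphD /= IHp IHq.
- by rewrite !rmorphM /= IHp IHq.
Qed.

Lemma restr_relation A l g : relation A l g -> restr A g = g.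
Proof.
case=> [[i iA ->]|[D [c [DA _ ->]]]].
  by rewrite rmorphB rmorphM /= !restrC restrX iA.
rewrite rmorph_sum; apply: eq_bigr => i iD; rewrite rmorphM /= restrC.
by rewrite restr_prod // (subset_trans (subsetDl _ _)).
Qed.

Lemma relation_mono A B l g : B \subset A -> relation B l g -> relation A l g.
Proof.
move=> BA [[i iB ->]|[D [c [DB e ->]]]]; [left|right].
  by exists i => //; apply: (subsetP BA).
by exists D, c; split=> //; apply: subset_trans BA.
Qed.

Lemma inv_eval_relation A l g :
  (forall i, i \in A -> l i != 0) -> relation A l g -> inv_eval l g = 0.
Proof.
move=> l0 [[i iA ->]|[D [c [/subsetP DA e ->]]]].
  by rewrite rmorphB rmorphM /= !inv_evalC inv_evalX mulrCA divff ?mulr1 ?subrr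
    ?frac_eq0 ?l0.
have h0 : h%:F != 0 :> K by rewrite frac_eq0.
(* The circuit evaluates to its dependency divided by [h], times the product of the values [h / l_r]
   over all of [D]. *)
rewrite rmorph_sum /=; transitivity
  ((\sum_(i in D) iota (c i) * l i)%:F / h%:F * \prod_(r in D) (h%:F / (l r)%:F) : K).
  rewrite rmorph_sum !mulr_suml; apply: eq_bigr => i iD.
  have li : (l i)%:F != 0 :> K by rewrite frac_eq0 l0 ?DA.
  rewrite (big_setD1 i iD) /= !rmorphM /= rmorph_prod inv_evalC.
  rewrite (eq_bigr _ (fun r _ => inv_evalX l r)).
  exact: mul_div_div.
by rewrite e rmorph0 !mul0r.
Qed.

Lemma inv_eval_ideal A l p : (forall i, i \in A -> l i != 0) ->
  ideal_gen (relation A l) p -> inv_eval l p = 0.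
Proof.
move=> l0; apply: (@ideal_gen_ind _ _ (fun q => inv_eval l q = 0)) => [|u v|a g].
  exact: rmorph0.
  by rewrite rmorphD /= => -> ->; rewrite addr0.
by rewrite rmorphM /= => /(inv_eval_relation l0) ->; rewrite mulr0.
Qed.

Lemma ideal_relationX A l i p : i \in A ->
  ideal_gen (relation A l) ((l i)%:MP * 'X_i * p - h%:MP * p).
Proof.
move=> iA; rewrite -mulrBl mulrC; apply/ideal_genM/ideal_gen_mem.
by left; exists i.
Qed.

(** For [j] in [B] the form [l j] is outside the kernel of [sigma], so [h / l j] lies in the local
    ring and specializes to [h / sigma (l j)]; [restr] removes all other variables. *)
Lemma inv_eval_local B l (sigma : {rmorphism R -> R}) p :
    sigma h = h ->
    (forall j, j \in B -> l j != 0) -> (forall j, j \in B -> sigma (l j) != 0) ->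
  local_graph sigma (inv_eval l (restr B p))
    (inv_eval (fun j => sigma (l j)) (map_mpoly sigma (restr B p))).
Proof.
move=> sh l0 sl0; apply: (@local_graph_mpoly _ _ _ sigma _
    (inv_eval l \o restr B)
    (inv_eval (fun j => sigma (l j)) \o (map_mpoly sigma \o restr B))) => [a|j] /=.
  by rewrite restrC map_mpolyC !inv_evalC; apply: local_graph_frac.
rewrite restrX; case: ifP => jB; last first.
  rewrite !rmorph0; rewrite -(rmorph0 frac) -{2}(rmorph0 sigma).
  exact: local_graph_frac.
rewrite map_mpolyX !inv_evalX.
by have := local_graph_div frac_inj h (l0 j jB) (sl0 j jB); rewrite sh.
Qed.

Lemma restr_map_mpoly B (sigma : {rmorphism R -> R}) p :
  restr B (map_mpoly sigma p) = map_mpoly sigma (restr B p).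
Proof.
elim/mpoly_ring_ind: p => [a|j|p q IHp IHq|p q IHp IHq].
- by rewrite restrC !map_mpolyC restrC.
- by rewrite map_mpolyX restrX; case: ifP => jB; rewrite ?map_mpolyX ?rmorph0 ?restrX ?jB.
- by rewrite !rmorphD /= IHp IHq.
- by rewrite !rmorphM /= IHp IHq.
Qed.

(* After multiplication by [l i ^+ d], all terms but the leading one lie in the
   kernel of [sigma]. *)
Lemma inv_eval_lead A l i (sigma : {rmorphism R -> R}) (P : {poly T}) :
    i \in A -> sigma h = h -> sigma (l i) = 0 ->
    (forall j, j \in A -> l j != 0) ->
    (forall j, j \in A :\ i -> sigma (l j) != 0) ->
    (forall e, restr (A :\ i) P`_e = P`_e) ->
    inv_eval l P.['X_i] = 0 ->
  inv_eval (fun j => sigma (l j)) (map_mpoly sigma (lead_coef P)) = 0.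
Proof.
move=> iA sh sli l0 sl0 rP evP.
have li0 : (l i)%:F != 0 :> K by rewrite frac_eq0 l0.
have [->|P0] := eqVneq P 0; first by rewrite lead_coef0 !rmorph0.
have [d sP] : exists d, size P = d.+1.
  by exists (size P).-1; rewrite prednK // lt0n size_poly_eq0.
(* At [y_i = h / l_i], the factor [l_i ^ d] turns [y_i ^ e] into [h ^ e l_i ^ (d - e)]. *)
have {}evP : \sum_(e < d.+1) inv_eval l P`_e * (h ^+ e * l i ^+ (d - e))%:F = 0.
  transitivity (inv_eval l P.['X_i] * (l i)%:F ^+ d); last by rewrite evP mul0r.
  rewrite horner_coef sP rmorph_sum mulr_suml.
  apply: eq_bigr => e _; rewrite !rmorphM !rmorphXn /= inv_evalX exprMn exprVn.
  have -> : (l i)%:F ^+ d = (l i)%:F ^+ (d - e) * (l i)%:F ^+ e :> K.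
    by rewrite -exprD subnK // -ltnS.
  by rewrite [_ * (l i)%:F ^+ e]mulrC [in RHS]mulrA -(mulrA _ (_ / _)) divfK ?expf_neq0 // mulrA.
have G (e : 'I_d.+1) : local_graph sigma
    (inv_eval l P`_e * (h ^+ e * l i ^+ (d - e))%:F)
    (inv_eval (fun j => sigma (l j)) (map_mpoly sigma P`_e) *
      (h ^+ e * 0 ^+ (d - e))%:F).
  apply: local_graphM; last first.
    have := local_graph_frac frac sigma (h ^+ e * l i ^+ (d - e)).
    by rewrite (rmorphM sigma) !(rmorphXn sigma) sh sli.
  rewrite -rP; apply: inv_eval_local => // j /setD1P[_ jA]; exact: l0.
(* The specialized sum vanishes as well. The factor [0 ^+ (d - e)] leaves only [e = d], the leading
   coefficient times [h ^ d], and [h] is nonzero. *)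
have := local_graph_sum (index_enum _) G; rewrite evP => /(local_graph_fun0 frac_inj)/eqP.
rewrite big_ord_recr /= big1 => [|e _]; last first.
  by rewrite expr0n subn_eq0 leqNgt ltn_ord mulr0 rmorph0 mulr0.
rewrite add0r subnn expr0 mulr1 mulf_eq0 frac_eq0 expf_eq0 (negbTE h_neq0) andbF orbF.
by rewrite lead_coefE sP => /eqP.
Qed.

(* Modulo the relations, [p y_i^d] has degree less than [d] in [y_i]. *)
Definition lowers A l i d p : Prop :=
  exists P : {poly T}, [/\ (size P <= d)%N, forall e, restr (A :\ i) P`_e = P`_e
    & ideal_gen (relation A l) (p * 'X_i ^+ d - P.['X_i])].

Lemma lowers_ideal A l i d p : ideal_gen (relation A l) p -> lowers A l i d p.
Proof.
move=> Ip; exists 0; split=> [|e|]; first by rewrite size_poly0.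
  by rewrite coef0 rmorph0.
by rewrite horner0 subr0 mulrC; apply: ideal_genM.
Qed.

Lemma lowersD A l i d p q :
  lowers A l i d p -> lowers A l i d q -> lowers A l i d (p + q).
Proof.
move=> [P [sP rP IP]] [Q [sQ rQ IQ]]; exists (P + Q); split.
- by apply: leq_trans (size_polyD _ _) _; rewrite geq_max sP.
- by move=> e; rewrite coefD rmorphD /= rP rQ.
have := ideal_genD IP IQ; congr ideal_gen; rewrite hornerD; ring.
Qed.

(** The polynomial of lower degree is [q y_i ^ d], obtained by trading one factor [p y_i] for
    [q]. *)
Lemma lowers_monom A l i d p q : restr (A :\ i) q = q ->
    ideal_gen (relation A l) (p * 'X_i - q) ->
  lowers A l i d.+1 p.
Proof.
move=> rq Iq; exists (q *: 'X^d); split=> [|e|].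
- by apply: leq_trans (size_scale_leq _ _) _; rewrite size_polyXn.
- by rewrite coefZ coefXn rmorphM rmorph_nat /= rq.
have := ideal_genM ('X_i ^+ d) Iq; congr ideal_gen; rewrite hornerZ hornerXn exprS; ring.
Qed.

(** The relation [l_i y_i - h] trades [l_i y_i] for [h]. *)
Lemma lowers_vanish A l i d p : i \in A -> restr (A :\ i) p = p ->
  lowers A l i d.+1 ((l i)%:MP * p).
Proof.
move=> iA rp; apply: (@lowers_monom _ _ _ _ _ (h%:MP * p)).
  by rewrite rmorphM /= rp restrC.
by rewrite mulrAC; apply: ideal_relationX.
Qed.

Lemma circuit_diffU1 D c i : i \notin D ->
  circuit_diff (i |: D) c
    = (iota (c i))%:MP * \prod_(r in D) 'X_r + circuit_diff D c * 'X_i.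
Proof.
move=> iD; rewrite /circuit_diff big_setU1 //= setU1K //; congr (_ + _).
rewrite mulr_suml; apply: eq_bigr => j jD; rewrite -mulrA; congr (_ * _).
have ji : i != j by apply: contraNneq iD => ->.
rewrite setDUl (setDidPl _); last by rewrite disjoints1 inE.
by rewrite big_setU1 ?inE ?(negbTE iD) ?andbF //= mulrC.
Qed.

Lemma eq_circuit_diff D c c' : {in D, c =1 c'} -> circuit_diff D c = circuit_diff D c'.
Proof. by move=> e; apply: eq_bigr => i iD; rewrite e. Qed.

(** [I] is any predicate closed under the ideal operations, so that both a sum of two ideals and a
    single [ideal_gen] are covered. *)
Lemma relation_rmorph (B : comNzRingType) (psi : {rmorphism T -> B})
    (I : B -> Prop) A l p :
    I 0 -> (forall u v, I u -> I v -> I (u + v)) -> (forall a u, I u -> I (a * u)) ->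
    (forall i, i \in A -> I (psi (l i)%:MP * psi 'X_i - psi h%:MP)) ->
    (forall D c, D \subset A -> \sum_(i in D) iota (c i) * l i = 0 ->
      I (\sum_(i in D) psi (iota (c i))%:MP * \prod_(r in D :\ i) psi 'X_r)) ->
  ideal_gen (relation A l) p -> I (psi p).
Proof.
move=> I0 ID IM IX Idiff; apply: (@ideal_gen_ind _ _ (fun p => I (psi p))).
- by rewrite rmorph0.
- by move=> u v; rewrite rmorphD; apply: ID.
move=> a g [[i iA ->]|[D [c [DA e ->]]]]; rewrite rmorphM; apply: IM.
  by rewrite rmorphB rmorphM; apply: IX.
rewrite rmorph_sum; under eq_bigr do rewrite rmorphM rmorph_prod.
exact: Idiff.
Qed.

Variable lin : R -> Prop.
(* [sigma] plays the role of the restriction to the hyperplane [v = 0]; being an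
   endomorphism of [R], it keeps the induction within one ring. *)
Hypothesis specialize : forall v, lin v -> v != 0 ->
  exists (sigma : {rmorphism R -> R}) (coef : R -> F),
    [/\ sigma h = h, sigma v = 0, forall a, exists b, a - sigma a = v * b
      & forall u, lin u -> lin (sigma u) /\ sigma u = u - iota (coef u) * v].

(** Both kinds of restricted relations lift to [A]: [sigma (l j)] differs from [l j] by a multiple
    of [l i], which [lowers_vanish] absorbs, and a restricted dependency extends by the index
    [i]. *)
Lemma lowers_specialized A l i d (sigma : {rmorphism R -> R}) (coef : R -> F) q :
    i \in A -> sigma h = h ->
    (forall j, j \in A -> sigma (l j) = l j - iota (coef (l j)) * l i) ->
    restr (A :\ i) q = q ->
    ideal_gen (relation (A :\ i) (fun j => sigma (l j))) q ->
  lowers A l i d.+1 q.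
Proof.
(* Applying [restr] fixes [q] and the generators, and makes the coefficients in front of the
   generators free of [y_i]. *)
move=> iA sh sE rq Iq; rewrite -rq.
move: q Iq {rq}; apply: ideal_gen_ind => [|p q IHp IHq|a g].
- by rewrite rmorph0; apply/lowers_ideal/ideal_gen0.
- by rewrite (rmorphD (restr _)); apply: lowersD.
move=> rg; rewrite rmorphM /= (restr_relation rg).
have ra := restr_idem (A :\ i) a; move: (restr _ a) ra => {}a ra.
case: rg => [[j jB ->]|[D [c [DB]]]].
  have jA : j \in A by case/setD1P: jB.
  rewrite sE //; have -> : a * ((l j - iota (coef (l j)) * l i)%:MP * 'X_j - h%:MP) =
      a * ((l j)%:MP * 'X_j - h%:MP) +
      (l i)%:MP * (a * - ((iota (coef (l j)))%:MP * 'X_j)).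
    by rewrite mpolyCB mpolyCM; ring.
  apply: lowersD.
    by apply/lowers_ideal/ideal_genM/ideal_gen_mem; left; exists j.
  by apply: lowers_vanish; rewrite // rmorphM rmorphN rmorphM /= ra restrC restrX jB.
have DA : D \subset A := subset_trans DB (subsetDl _ _).
have iD : i \notin D by apply/negP => /(subsetP DB); rewrite !inE eqxx.
(* Restriction subtracts [coef (l j) l_i] from each [l_j]; the coefficient [s] on [l_i] collects
   these corrections. *)
move=> e ->; pose s := - \sum_(j in D) c j * coef (l j).
pose c' j := if j == i then s else c j.
have cc' : {in D, c' =1 c}.
  by move=> j jD; rewrite /c' ifN //; apply: contraNneq iD => <-.
apply: (@lowers_monom _ _ _ _ _ (a * - ((iota s)%:MP * \prod_(r in D) 'X_r))).
  by rewrite rmorphM rmorphN rmorphM /= ra restrC restr_prod.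
have -> : a * circuit_diff D c * 'X_i - a * - ((iota s)%:MP * \prod_(r in D) 'X_r)
    = a * circuit_diff (i |: D) c'.
  rewrite circuit_diffU1 // {1}/c' eqxx (eq_circuit_diff cc'); ring.
apply/ideal_genM/ideal_gen_mem; right; exists (i |: D), c'; split=> //.
  by rewrite subUset sub1set iA.
transitivity (\sum_(j in D) iota (c j) * sigma (l j)); last exact: e.
rewrite big_setU1 //= {1}/c' eqxx /s rmorphN rmorph_sum mulNr mulr_suml addrC.
rewrite -sumrB; apply: eq_bigr => j jD; rewrite cc' // sE ?(subsetP DA) //.
by rewrite rmorphM; ring.
Qed.

Lemma specialize_mpoly (sigma : {rmorphism R -> R}) v p :
    (forall a, exists b, a - sigma a = v * b) ->
  exists q, p = map_mpoly sigma p + v%:MP * q.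
Proof.
move=> sE; elim/mpoly_ring_ind: p => [a|i|p q [p' IHp] [q' IHq]|p q [p' IHp] [q' IHq]].
- have [b ab] := sE a; exists b%:MP.
  by rewrite map_mpolyC -mpolyCM -ab -mpolyCD; congr mpolyC; ring.
- by exists 0; rewrite map_mpolyX mulr0 addr0.
- by exists (p' + q'); rewrite rmorphD /= {1}IHp {1}IHq; ring.
- exists (p' * q + map_mpoly sigma p * q').
  rewrite rmorphM /= {1}IHp mulrDl {1}IHq; ring.
Qed.

(** Gives access to the degree and the leading coefficient in [y_i]. The coefficients stay in [T],
    with [restr] recording that they avoid [y_i], so the ring never changes during the induction. *)
Lemma restr_horner A i p : i \in A ->
  exists P : {poly T}, (forall e, restr (A :\ i) P`_e = P`_e) /\ restr A p = P.['X_i].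
Proof.
move=> iA; elim/mpoly_ring_ind: p => [a|j|p q|p q].
- exists (a%:MP)%:P; rewrite restrC hornerC; split=> // e.
  by rewrite coefC; case: ifP; rewrite ?restrC ?rmorph0.
- rewrite restrX; have [->|ji] := eqVneq j i.
    exists 'X; rewrite iA hornerX; split=> // e.
    by rewrite coefX rmorph_nat.
  exists (if j \in A then 'X_j else 0)%:P; rewrite hornerC; split=> // e.
  rewrite coefC; case: ifP => _; last by rewrite rmorph0.
  by case: ifP => jA; rewrite ?rmorph0 // restrX !inE ji jA.
- move=> [P [rP pP]] [Q [rQ qQ]]; exists (P + Q).
  by split=> [e|]; rewrite ?coefD !rmorphD /= ?rP ?rQ ?pP ?qQ ?hornerD.
- move=> [P [rP pP]] [Q [rQ qQ]]; exists (P * Q).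
  split=> [e|]; last by rewrite rmorphM /= pP qQ hornerM.
  rewrite coefM rmorph_sum; apply: eq_bigr => j _.
  by rewrite rmorphM /= rP rQ.
Qed.

Theorem inv_eval_ker A l p :
    (forall i, i \in A -> lin (l i) /\ l i != 0) ->
    restr A p = p -> inv_eval l p = 0 ->
  ideal_gen (relation A l) p.
Proof.
(* Outer induction on the number of forms. The family [l] varies too, since the hypothesis serves
   both for [l] and for its restriction. *)
have [m] := ubnP #|A|; elim: m => // m IHm in A l p *.
rewrite ltnS => cA lA rp evp.
have l0 i : i \in A -> l i != 0 by case/lA.
have [A0|[i iA]] := set_0Vmem A.
  (* Without variables [p] is a constant, and [frac] is injective. *)
  suff [a pa] : exists a, p = a%:MP.
    move: evp; rewrite pa inv_evalC => /eqP; rewrite frac_eq0 => /eqP->.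
    by rewrite mpolyC0; apply: ideal_gen0.
  rewrite -{}rp; elim/mpoly_ring_ind: p {evp} => [a|i|p q [a pa] [b qb]|p q [a pa] [b qb]].
  - by exists a; rewrite restrC.
  - by exists 0; rewrite restrX A0 inE mpolyC0.
  - by exists (a + b); rewrite rmorphD /= pa qb mpolyCD.
  - by exists (a * b); rewrite rmorphM /= pa qb mpolyCM.
have cB : (#|A :\ i| < m)%N by apply: leq_trans cA; rewrite [X in (_ < X)%N](cardsD1 i) iA.
have [lin_i li0] := lA i iA.
have [sigma [coef [sh sli sR slin]]] := specialize lin_i li0.
have sE j : j \in A -> sigma (l j) = l j - iota (coef (l j)) * l i.
  by case/lA => /slin[].
have [P [rP]] := restr_horner p iA; rewrite rp => pP.
rewrite {}pP in evp *; clear p rp.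
(* Inner induction on the degree in [y_i]. *)
have [d] := ubnP (size P); elim: d => // d IHd in P rP evp *; rewrite ltnS => sP.
have [sP1|sP1] := leqP (size P) 1.
  (* Here [y_i] does not occur, so the outer hypothesis applies to [A :\ i] with the same forms. *)
  move: evp; rewrite (size1_polyC sP1) hornerC => evp.
  apply: (@ideal_gen_sub _ (relation (A :\ i) l)).
    by move=> g /(relation_mono (subsetDl _ _)) Gg; apply: ideal_gen_mem.
  by apply: IHm => // j /setD1P[_]; apply: lA.
case sPe : (size P) sP1 => [//|[//|e]] _.
suff [Q [sQ rQ IQ]] : lowers A l i e.+1 (lead_coef P).
  have IQ0 := inv_eval_ideal l0 IQ.
  (* [P'] is [P] with its leading term replaced by [Q]. The difference lies in the ideal, so [P']
     still evaluates to zero, in lower degree. *)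
  pose P' := P - lead_coef P *: 'X^(e.+1) + Q.
  have PE : P.['X_i] = (lead_coef P * 'X_i ^+ e.+1 - Q.['X_i]) + P'.['X_i].
    by rewrite /P' !hornerD hornerN hornerZ hornerXn; ring.
  rewrite PE; apply: ideal_genD => //; apply: IHd.
  - move=> f; rewrite /P' coefD coefB coefZ coefXn rmorphD rmorphB rmorphM /=.
    by rewrite rmorph_nat rQ lead_coefE !rP.
  - by move: evp; rewrite PE rmorphD /= IQ0 add0r.
  apply: leq_trans sP; rewrite sPe ltnS; apply: leq_trans (size_polyD _ _) _.
  rewrite geq_max sQ andbT; apply/leq_sizeP => f ef.
  rewrite coefB coefZ coefXn; have [->|fe] := eqVneq f e.+1.
    by rewrite mulr1 lead_coefE sPe subrr.
  by rewrite mulr0 subr0 nth_default // sPe ltn_neqAle eq_sym fe.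
have rL : restr (A :\ i) (lead_coef P) = lead_coef P by rewrite lead_coefE rP.
have jA j : j \in A :\ i -> j \in A by case/setD1P.
case: (boolP [exists j in A :\ i, sigma (l j) == 0])
    => [/exists_inP[j jB /eqP slj]|/exists_inPn nsl].
  (* A form restricting to zero is a multiple of [l i]. The coefficients [- coef (l j)] on [i] and
     [1] on [j] give the circuit [y_i - coef (l j) y_j], so [y_i] can be traded for a multiple of
     [y_j]. *)
  have lj : l j = iota (coef (l j)) * l i.
    by apply/eqP; rewrite -subr_eq0 -sE ?jA // slj.
  pose c k := if k == i then - coef (l j) else 1.
  have ji : j != i by case/setD1P: jB.
  apply: (@lowers_monom _ _ _ _ _ (lead_coef P * ((iota (coef (l j)))%:MP * 'X_j))).
    by rewrite !rmorphM /= rL restrC restrX jB.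
  rewrite -mulrBr; apply/ideal_genM/ideal_gen_mem; right; exists [set i; j], c.
  have iDj : i \notin [set j] by rewrite inE eq_sym.
  split; first by rewrite subUset !sub1set iA jA.
    rewrite big_setU1 //= big_set1 /c eqxx (negbTE ji) rmorphN rmorph1 mul1r.
    by rewrite mulNr -lj addNr.
  rewrite circuit_diffU1 // big_set1 /circuit_diff big_set1 setDv big_set0.
  by rewrite /c eqxx (negbTE ji) rmorphN rmorph1 mpolyCN mpolyC1; ring.
(* No form restricts to zero. Up to a multiple of [l i], the leading coefficient equals its image
   under [sigma], which [inv_eval_lead] puts in the kernel for fewer forms. *)
have [q Lq] := specialize_mpoly (lead_coef P) sR.
have := congr1 (restr (A :\ i)) Lq.
rewrite rmorphD (rmorphM (restr _)) /= restrC restr_map_mpoly rL => ->.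
apply: lowersD; last by apply: lowers_vanish; rewrite ?restr_idem.
apply: (lowers_specialized e iA sh sE).
  by rewrite restr_map_mpoly rL.
apply: IHm => //.
- by move=> j /[dup] jB /nsl sj; split=> //; case: (lA j (jA j jB)) => /slin[].
- by rewrite restr_map_mpoly rL.
- by apply: (inv_eval_lead iA sh sli).
Qed.

End Relations.

(** * Linear forms and restriction to a hyperplane *)

Section LinearForms.
Variables (F : fieldType) (k : nat).
Local Notation R := {mpoly F[k]}.
Implicit Types (u v p : R) (i : 'I_k).

Lemma homog1E v : v \is 1.-homog -> v = \sum_i v@_U_(i) *: 'X_i.
Proof.
move=> hv; apply/mpolyP => m; rewrite raddf_sum /=.
have [/mdeg1P[j /eqP->]|m1] := boolP (mdeg m == 1%N).
  rewrite (bigD1 j) //= mcoeffZ mcoeffXU eqxx mulr1 big1 ?addr0 // => i ij.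
  by rewrite mcoeffZ mcoeffXU (negbTE ij) mulr0.
rewrite (dhomog_nemf_coeff hv m1) big1 // => i _; rewrite mcoeffZ mcoeffX.
by have [e|_] := eqVneq U_(i)%MM m; [move: m1; rewrite -e mdeg1 | rewrite mulr0].
Qed.

(** For a linear form [v] involving [x_i], this solves [v = 0] for [x_i] and fixes the other
    variables: restriction to the hyperplane, as an endomorphism of [R]. *)
Definition eliminate v i : R -> R :=
  mmap (@mpolyC k F) (fun j => 'X_j - (if j == i then (v@_U_(i))^-1 else 0) *: v).
HB.instance Definition _ v i := GRing.RMorphism.copy (eliminate v i)
  (mmap (@mpolyC k F) (fun j => 'X_j - (if j == i then (v@_U_(i))^-1 else 0) *: v)).

Lemma eliminateC v i c : eliminate v i c%:MP = c%:MP.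
Proof. exact: mmapC. Qed.

Lemma eliminateX v i j :
  eliminate v i 'X_j = 'X_j - (if j == i then (v@_U_(i))^-1 else 0) *: v.
Proof. by rewrite [LHS]mmapX mmap1U. Qed.

Lemma eliminate_mod v i p : exists q, p - eliminate v i p = v * q.
Proof.
elim/mpoly_ring_ind: p => [c|j|p q [p' IHp] [q' IHq]|p q [p' IHp] [q' IHq]].
- by exists 0; rewrite eliminateC subrr mulr0.
- exists (if j == i then (v@_U_(i))^-1 else 0)%:MP.
  by rewrite eliminateX opprB addrC subrK mulrC mul_mpolyC.
- by exists (p' + q'); rewrite rmorphD /= mulrDr -IHp -IHq; ring.
- exists (p' * q + eliminate v i p * q').
  by rewrite rmorphM /= mulrDr mulrA mulrCA -IHp -IHq; ring.
Qed.

Lemma eliminate_homog1 v i u : u \is 1.-homog ->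
  eliminate v i u = u - (u@_U_(i) / v@_U_(i)) *: v.
Proof.
move=> hu; rewrite {1}(homog1E hu) rmorph_sum {2}(homog1E hu) /=.
transitivity (\sum_j (u@_U_(j) *: 'X_j
    - (if j == i then u@_U_(i) / v@_U_(i) else 0) *: v)).
  apply: eq_bigr => j _; rewrite -mul_mpolyC rmorphM /= eliminateC eliminateX.
  rewrite !mul_mpolyC scalerBr scalerA; congr (_ - _ *: _).
  by have [->|_] := eqVneq j i; rewrite ?mulr0.
rewrite sumrB -scaler_suml; congr (_ - _ *: _).
by rewrite -big_mkcond big_pred1_eq.
Qed.

Definition scalar : {rmorphism F -> {poly R}} := @polyC R \o @mpolyC k F.

Definition linear_form (w : {poly R}) : Prop := exists2 v, v \is 1.-homog & w = v%:P.

(** Provides the hypothesis [specialize] with [h] the variable of [{poly R}]: elimination acts on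
    the coefficients and so fixes [h]. *)
Lemma specialize_linear_form (w : {poly R}) : linear_form w -> w != 0 ->
  exists (sigma : {rmorphism {poly R} -> {poly R}}) (coef : {poly R} -> F),
    [/\ sigma 'X = 'X, sigma w = 0, forall a, exists b, a - sigma a = w * b
      & forall w', linear_form w' ->
          linear_form (sigma w') /\ sigma w' = w' - scalar (coef w') * w].
Proof.
move=> [v hv ->]; rewrite polyC_eq0 => v0.
have [i vi] : exists i, v@_U_(i) != 0.
  apply/existsP; apply: contraNT v0 => /existsPn v0.
  rewrite (homog1E hv) big1 // => i _.
  by move: (v0 i); rewrite negbK => /eqP->; rewrite scale0r.
(* Linear forms are constant in [h], so coefficient 0 of [w'] recovers the form. *)
exists (map_poly (eliminate v i)), (fun w' => (w'`_0)@_U_(i) / v@_U_(i)); split.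
- exact: map_polyX.
- by rewrite /= map_polyC /= eliminate_homog1 // divff // scale1r subrr.
- elim/poly_ind => [|p c [q IHp]]; first by exists 0; rewrite rmorph0 subrr mulr0.
  have [d IHc] := eliminate_mod v i c; exists (q * 'X + d%:P).
  rewrite rmorphD rmorphM /= map_polyX map_polyC /=.
  rewrite mulrDr mulrA -IHp -polyCM -IHc polyCB; ring.
move=> _ [u hu ->]; rewrite /= map_polyC /= eliminate_homog1 //; split.
  by exists (u - (u@_U_(i) / v@_U_(i)) *: v) => //; apply/rpredB => //; apply: rpredZ.
by rewrite coefC eqxx -mul_mpolyC polyCB polyCM.
Qed.

End LinearForms.

(** * The Rees, symmetric and Orlik-Terao ideals of the arrangement *)

Section Arrangement.
Variables (F : fieldType) (k n : nat) (ell : 'I_n -> {mpoly F[k]}).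
Local Notation R := {mpoly F[k]}.
Local Notation S := {mpoly F[n]}.
Local Notation T := {mpoly {mpoly F[k]}[n]}.
Hypothesis ell_homog : forall i, ell i \is 1.-homog.
Hypothesis ell_neq0 : forall i, ell i != 0.

HB.instance Definition _ := GRing.RMorphism.copy (rees_map ell)
  (mmap (@polyC R) (fun i => fold_gen ell i *: 'X)).
HB.instance Definition _ := GRing.RMorphism.copy (@y_incl F k n)
  (map_mpoly (@mpolyC k F)).

Lemma rees_mapC a : rees_map ell a%:MP = a%:P.
Proof. exact: mmapC. Qed.

Lemma rees_mapX i : rees_map ell 'X_i = fold_gen ell i *: 'X.
Proof. by rewrite [LHS]mmapX mmap1U. Qed.

Lemma rees_map_prodX (D : {set 'I_n}) :
  rees_map ell (\prod_(r in D) 'X_r) = \prod_(r in D) (fold_gen ell r *: 'X).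
Proof. by rewrite rmorph_prod; apply: eq_bigr => r _; apply: rees_mapX. Qed.

Lemma y_inclC c : y_incl k c%:MP = c%:MP%:MP :> T.
Proof. exact: map_mpolyC. Qed.

Lemma y_inclX i : y_incl k 'X_i = 'X_i :> T.
Proof. exact: map_mpolyX. Qed.

Lemma y_incl_dependency_diff (D : {set 'I_n}) (c : 'I_n -> F) : y_incl k (dependency_diff D c) =
  \sum_(i in D) (c i)%:MP%:MP * \prod_(r in D :\ i) 'X_r.
Proof.
rewrite rmorph_sum; apply: eq_bigr => i _; rewrite -mul_mpolyC rmorphM /= y_inclC.
by rewrite rmorph_prod; congr (_ * _); apply: eq_bigr => r _; apply: y_inclX.
Qed.

Lemma ell_fold_gen i : ell i * fold_gen ell i = \prod_j ell j.
Proof. by rewrite [RHS](bigD1 i). Qed.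

Lemma prod_ell_neq0 : \prod_j ell j != 0.
Proof. by apply/prodf_neq0. Qed.

Lemma rees_ideal_gen (G : T -> Prop) p :
  (forall g, G g -> rees_ideal ell g) -> ideal_gen G p -> rees_ideal ell p.
Proof.
move=> GR; rewrite /rees_ideal; apply: (@ideal_gen_ind _ _ (rees_ideal ell)).
- exact: rmorph0.
- by move=> u v; rewrite /rees_ideal rmorphD /= => -> ->; rewrite addr0.
- by move=> a g /GR; rewrite /rees_ideal rmorphM /= => ->; rewrite mulr0.
Qed.

Lemma sym_ideal_rees p : sym_ideal ell p -> rees_ideal ell p.
Proof.
apply: rees_ideal_gen => _ [s [s0 ->]]; rewrite /rees_ideal rmorph_sum /=.
transitivity ((\sum_i s i * fold_gen ell i) *: 'X : {poly R}); last by rewrite s0 scale0r.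
rewrite scaler_suml; apply: eq_bigr => i _.
by rewrite -mul_mpolyC rmorphM /= rees_mapC rees_mapX mul_polyC scalerA.
Qed.

Lemma dependency_diff_rees0 (D : {set 'I_n}) (c : 'I_n -> F) :
  \sum_(i in D) c i *: ell i = 0 -> rees_ideal0 ell (dependency_diff D c).
Proof.
move=> e; rewrite /rees_ideal0 /rees_ideal y_incl_dependency_diff rmorph_sum /=.
have pi0 : (\prod_j ell j)%:P != 0 :> {poly R} by rewrite polyC_eq0 prod_ell_neq0.
have XD : 'X != 0 :> {poly R} by rewrite polyX_eq0.
(* Multiplying by [t prod_j ell_j = ell_i f_i t] completes the product in each term, and the
   dependency factors out. *)
apply: (mulfI (mulf_neq0 pi0 XD)); rewrite mulr0.
transitivity ((\sum_(i in D) c i *: ell i)%:P * \prod_(r in D) (fold_gen ell r *: 'X)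
    : {poly R}); last by rewrite e mul0r.
rewrite mulr_sumr raddf_sum mulr_suml; apply: eq_bigr => i iD.
rewrite rmorphM /= rees_mapC rees_map_prodX.
rewrite (big_setD1 i iD) /= -(ell_fold_gen i) -mul_mpolyC -mul_polyC !polyCM; ring.
Qed.

(** Indices with zero coefficient only contribute a common monomial factor, and the remaining ones
    form a genuine dependency. *)
Lemma dependency_diff_orlik_terao (D : {set 'I_n}) (c : 'I_n -> F) :
  \sum_(i in D) c i *: ell i = 0 -> orlik_terao_ideal ell (dependency_diff D c).
Proof.
pose E := [set i | c i != 0] => e.
have -> : dependency_diff D c =
    \prod_(r in D :\: E) 'X_r * dependency_diff (D :&: E) c.
  rewrite {1}/dependency_diff (big_setID E) /= [X in _ + X]big1 => [|i]; last first.
    by rewrite !inE negbK => /andP[/eqP-> _]; rewrite scale0r.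
  rewrite addr0 mulr_sumr; apply: eq_bigr => i; rewrite inE => /andP[iD iE].
  rewrite -scalerAr; congr (_ *: _); rewrite (big_setID E) /= mulrC.
  congr (_ * _).
    by apply: eq_bigl => r; rewrite !in_setD in_set1; have [->|] := eqVneq r i; rewrite ?iE.
  by apply: eq_bigl => r; rewrite !inE andbA.
apply/ideal_genM/ideal_gen_mem; exists (D :&: E), c; split=> //; split.
  by move=> i; rewrite !inE => /andP[].
move: e; rewrite (big_setID E) /= [X in _ + X]big1 ?addr0 // => i.
by rewrite !inE negbK => /andP[/eqP-> _]; rewrite scale0r.
Qed.

Local Notation T' := {mpoly {poly {mpoly F[k]}}[n]}.
Local Notation relations :=
  (relation (scalar F k) 'X [set: 'I_n] (fun i => (ell i)%:P)).

(** At [t = h / prod_j ell_j] the image [f_i t] of [y_i] becomes [h / ell_i], so the evaluation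
    factors through the Rees map. The variable of [rees_map] is [t], that of the coefficients in
    [T'] is [h]. *)
Lemma inv_eval_rees_map (K : fieldType) (frac : {rmorphism {poly R} -> K}) p :
    injective frac ->
  inv_eval frac 'X (fun i => (ell i)%:P) (map_mpoly (@polyC R) p)
    = (map_poly (frac \o @polyC R) (rees_map ell p)).[frac 'X / frac (\prod_j ell j)%:P].
Proof.
move=> finj; set z := _ / _.
apply: (mpoly_rmorph_ext
  (f := inv_eval frac 'X (fun i => (ell i)%:P) \o map_mpoly (@polyC R))
  (g := horner_eval z \o (map_poly (frac \o @polyC R) \o rees_map ell))) => [a|i] /=.
  by rewrite map_mpolyC inv_evalC rees_mapC map_polyC /= /horner_eval hornerC.
rewrite map_mpolyX inv_evalX rees_mapX -mul_polyC rmorphM /= map_polyC map_polyX /=.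
rewrite /horner_eval hornerCM hornerX /z -(ell_fold_gen i) polyCM rmorphM.
rewrite invfM mulrCA [in RHS](mulrCA (frac (fold_gen ell i)%:P)) divff ?mulr1 //.
rewrite frac_eq0 // polyC_eq0; apply: contraNneq prod_ell_neq0 => f0.
by rewrite -(ell_fold_gen i) f0 mulr0.
Qed.

Lemma rees_ideal_relations p :
  rees_ideal ell p -> ideal_gen relations (map_mpoly (@polyC R) p).
Proof.
move=> pR; have finj : injective (@tofrac {poly R}).
  by move=> a b /eqP; rewrite tofrac_eq => /eqP.
apply: (@inv_eval_ker _ _ _ _ (@tofrac {poly R}) finj (scalar F k) 'X _ (@linear_form F k)
    (@specialize_linear_form F k)).
- by rewrite polyX_eq0.
- by move=> i _; split; [exists (ell i) | rewrite polyC_eq0].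
- apply: (mpoly_rmorph_ext (f := restr _) (g := idfun)) => [a|i] /=.
    exact: restrC.
  by rewrite restrX inE.
- by rewrite inv_eval_rees_map // pR rmorph0 horner0.
Qed.

Lemma relation_sum0 (D : {set 'I_n}) (c : 'I_n -> F) :
  \sum_(i in D) scalar F k (c i) * (ell i)%:P = 0 -> \sum_(i in D) c i *: ell i = 0.
Proof.
move=> e; apply: polyC_inj; apply: (etrans _ e); rewrite raddf_sum.
by apply: eq_bigr => i _; rewrite /= -mul_mpolyC polyCM.
Qed.

Lemma rees_ideal_fiber (i0 : 'I_n) p : rees_ideal ell p ->
  ideal_add (sym_ideal ell) (rees_ideal0_ext ell) p.
Proof.
move=> /rees_ideal_relations Ip.
pose h : T := (ell i0)%:MP * 'X_i0.
pose psi0 : {rmorphism {poly R} -> T} := horner_eval h \o map_poly (@mpolyC n R).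
have psi0C a : psi0 a%:P = a%:MP by rewrite /= /horner_eval map_polyC hornerC.
have psi0X : psi0 'X = h by rewrite /= /horner_eval map_polyX hornerX.
pose psi : {rmorphism T' -> T} := mmap psi0 (fun i => 'X_i).
have psiC a : psi a%:MP = psi0 a by apply: mmapC.
have psiX i : psi 'X_i = 'X_i by rewrite [LHS]mmapX mmap1U.
clearbody psi psi0.
have <- : psi (map_mpoly (@polyC R) p) = p.
  apply: (mpoly_rmorph_ext (f := psi \o map_mpoly (@polyC R)) (g := idfun)) => [a|i] /=.
    by rewrite map_mpolyC psiC psi0C.
  by rewrite map_mpolyX psiX.
apply: (relation_rmorph (@ideal_add0 _ _ _) (@ideal_addD _ _ _) (@ideal_addM _ _ _) _ _ Ip)
    => [i _|D c _ e].
  rewrite !psiC psiX psi0C psi0X.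
  exists ((ell i)%:MP * 'X_i - h), 0; rewrite addr0; split=> //; last exact: ideal_gen0.
  apply: ideal_gen_mem.
  (* The syzygy [ell_i f_i = ell_i0 f_i0]; as a difference of two indicators it also covers
     [i = i0]. *)
  exists (fun j => (if j == i then ell i else 0) - (if j == i0 then ell i0 else 0)).
  split.
    under eq_bigr do rewrite mulrBl; rewrite sumrB; apply/eqP; rewrite subr_eq0; apply/eqP.
    rewrite (bigD1 i) //= eqxx big1 ?addr0 => [|j /negbTE->]; last by rewrite mul0r.
    rewrite (bigD1 i0) //= eqxx big1 ?addr0 => [|j /negbTE->]; last by rewrite mul0r.
    by rewrite !ell_fold_gen.
  under eq_bigr do rewrite scalerBl; rewrite sumrB /h; congr (_ - _).
    rewrite (bigD1 i) //= eqxx big1 ?addr0 ?mul_mpolyC // => j /negbTE->.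
    by rewrite scale0r.
  rewrite (bigD1 i0) //= eqxx big1 ?addr0 ?mul_mpolyC // => j /negbTE->.
  by rewrite scale0r.
exists 0; eexists; rewrite add0r; split; first exact: ideal_gen0; last by [].
apply: ideal_gen_mem; exists (dependency_diff D c); split.
  exact/dependency_diff_rees0/relation_sum0.
rewrite y_incl_dependency_diff; apply: eq_bigr => i _.
by rewrite psiC psi0C; congr (_ * _); apply: eq_bigr => r _; apply: psiX.
Qed.

Lemma rees_ideal0_orlik_terao q : rees_ideal0 ell q -> orlik_terao_ideal ell q.
Proof.
move=> /rees_ideal_relations Iq.
(* Sets [h] to zero, then takes the constant term in [x]. *)
pose chi0 : {rmorphism {poly R} -> S} :=
  @mpolyC n F \o (mcoeff 0%MM \o horner_eval (0 : R)).
have chi0C a : chi0 a%:P = (a@_0%MM)%:MP by rewrite /= /horner_eval hornerC.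
have chi0X : chi0 'X = 0 by rewrite /= /horner_eval hornerX mcoeff0 mpolyC0.
pose chi : {rmorphism T' -> S} := mmap chi0 (fun i => 'X_i).
have chiC a : chi a%:MP = chi0 a by apply: mmapC.
have chiX i : chi 'X_i = 'X_i by rewrite [LHS]mmapX mmap1U.
clearbody chi chi0.
have <- : chi (map_mpoly (@polyC R) (y_incl k q)) = q.
  apply: (mpoly_rmorph_ext (f := chi \o (map_mpoly (@polyC R) \o @y_incl F k n))
    (g := idfun)) => [c|i] /=.
    by rewrite y_inclC map_mpolyC chiC chi0C mcoeffC eqxx mulr1.
  by rewrite y_inclX map_mpolyX chiX.
apply: (relation_rmorph (@ideal_gen0 _ _) (@ideal_genD _ _) (@ideal_genM _ _) _ _ Iq)
    => [i _|D c _ e].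
  rewrite !chiC chi0C chi0X subr0.
  (* A linear form has no constant term, so [ell_i y_i - h] maps to zero. *)
  have m0 : mdeg (0%MM : 'X_{1..k}) != 1%N by rewrite mdeg0.
  rewrite (dhomog_nemf_coeff (ell_homog i) m0) mpolyC0 mul0r.
  exact: ideal_gen0.
suff -> : \sum_(i in D) chi (scalar F k (c i))%:MP * \prod_(r in D :\ i) chi 'X_r
    = dependency_diff D c.
  exact/dependency_diff_orlik_terao/relation_sum0.
apply: eq_bigr => i _; rewrite chiC chi0C mcoeffC eqxx mulr1 mul_mpolyC.
by congr (_ *: _); apply: eq_bigr => r _; apply: chiX.
Qed.

End Arrangement.

Theorem theorem4p2 (F : fieldType) (k n : nat) (hk : (2 <= k)%N)
    (hn : (k <= n)%N) (ell : 'I_n -> {mpoly F[k]})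
    (hA : central_arrangement ell) :
  fiber_type ell /\
  ideal_eq (ideal_gen (rees_ideal0 ell)) (orlik_terao_ideal ell).
Proof.
have [ell_homog ell_neq0 _ _] := hA.
(* Some form must exist to serve as [ell_i0] in the substitution for [h]. *)
have n_gt0 : (0 < n)%N by apply: leq_trans hn; apply: leq_trans hk.
split=> p; split.
- exact: (rees_ideal_fiber ell_homog ell_neq0 (Ordinal n_gt0)).
- move=> [u [v [/sym_ideal_rees uR vR ->]]].
  rewrite /rees_ideal rmorphD /= uR add0r.
  by apply: rees_ideal_gen vR => _ [q [qR ->]].
- apply: ideal_gen_sub => q; exact: rees_ideal0_orlik_terao.
- apply: ideal_gen_sub => _ [D [c [[_ e] ->]]]; apply: ideal_gen_mem.
  exact: dependency_diff_rees0.
Qed.
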